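(* Let $(E,d)$ be a complete geodesic metric space with convex metric, the geodesic extension property and curvature bounded below by $\kappa<0$. Suppose $A\in P_{b,cl}(E)$. Then the set \[\mathcal{W}_{max}=\left\{X\in P_{b,cl,cv}(E) : \max(A,X)\text{ is well-posed}\right\}\] is a dense $G_\delta$-set in $P_{b,cl,cv}(E)$ (with respect to the Pompeiu-Hausdorff distance).
   Context: Let $(E,d)$ be a metric space. A geodesic path from $x$ to $y$ is a map $c:[0,l]\to E$ with $c(0)=x$, $c(l)=y$ and $d(c(t),c(t'))=|t-t'|$ for all $t,t'\in[0,l]$; its image is a geodesic segment joining $x$ and $y$. $E$ is a geodesic space if every two points are joined by a geodesic path. A geodesic in $E$ is (the image of) a distance-preserving map from $\mathbb{R}$ into $E$. $E$ has the geodesic extension property if each geodesic segment is contained in a geodesic. A subset $X\subseteq E$ is convex if every geodesic segment joining two points of $X$ is contained in $X$. The metric of a geodesic space is convex if for any geodesic paths $c_1:[0,l_1]\to E$, $c_2:[0,l_2]\to E$ with $c_1(0)=c_2(0)$ one has $d(c_1(tl_1),c_2(tl_2))\le t\,d(c_1(l_1),c_2(l_2))$ for all $t\in[0,1]$. Curvature bounded below by $\kappa<0$: let $M^2_\kappa$ be the hyperbolic plane $\mathbb{H}^2$ with its distance multiplied by $1/\sqrt{-\kappa}$. A geodesic triangle $\Delta$ consists of three vertices $x_1,x_2,x_3\in E$ and three geodesic segments (edges), one joining each pair of vertices. A $\kappa$-comparison triangle is a geodesic triangle $\bar\Delta$ in $M^2_\kappa$ with vertices $\bar x_1,\bar x_2,\bar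 x_3$ such that $d(x_i,x_j)=d_{M^2_\kappa}(\bar x_i,\bar x_j)$ for all $i,j$ (it exists and is unique up to isometry). For a point $x$ on the edge $[x_i,x_j]$, the corresponding point $\bar x$ is the point of $[\bar x_i,\bar x_j]$ with $d_{M^2_\kappa}(\bar x,\bar x_i)=d(x,x_i)$. The geodesic space $E$ has curvature bounded below by $\kappa$ if for every geodesic triangle $\Delta$, every $\kappa$-comparison triangle $\bar\Delta$ and all $x,y\in\Delta$ one has $d(x,y)\ge d_{M^2_\kappa}(\bar x,\bar y)$ (reversed CAT$(\kappa)$ inequality). $P_{b,cl}(E)$ is the family of nonempty, bounded, closed subsets of $E$; $P_{b,cl,cv}(E)$ is the family of nonempty, bounded, closed, convex subsets of $E$. Both carry the Pompeiu-Hausdorff distance $h(X,Y)=\max\{\sup_{x\in X}\mathrm{dist}(x,Y),\sup_{y\in Y}\mathrm{dist}(y,X)\}$, where $\mathrm{dist}(z,X)=\inf_{x\in X}d(z,x)$. For $X,Y\in P_{b,cl}(E)$ put $\mu_{XY}=\sup\{d(x,y):x\in X,y\in Y\}$. The problem $\max(X,Y)$ consists in finding $(x_0,y_0)\in X\times Y$ (a solution) with $d(x_0,y_0)=\mu_{XY}$. A maximizing sequence is a sequence $(x_n,y_n)$ in $X\times Y$ with $d(x_n,y_n)\to\mu_{XY}$. The problem $\max(X,Y)$ is well-posed if it has a unique solution $(x_0,y_0)$ and every maximizing sequence $(x_n,y_n)$ satisfies $x_n\to x_0$ and $y_n\to y_0$. *)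

(* Defs.v *)
From HB Require Import structures.
From mathcomp Require Import all_boot all_order all_algebra.
From mathcomp Require Import all_classical all_reals all_analysis.

Set Implicit Arguments.
Unset Strict Implicit.
Unset Printing Implicit Defensive.

Import Order.TTheory GRing.Theory Num.Theory.
Import numFieldNormedType.Exports.

Local Open Scope classical_set_scope.
Local Open Scope ring_scope.

(* The distance [d] is a parameter because these notions are used both in E
   and in the hyperbolic comparison plane. *)
Section geodesics.
Context {R : realType} {T : Type} (d : T -> T -> R).

(* A path defined on [0, l] is represented by a total function on R whose
   values outside of [0, l] are irrelevant. *)
Definition geodesic_path (x y : T) (l : R) (c : R -> T) : Prop :=
  [/\ 0 <= l, c 0 = x, c l = y &
      {in `[0, l] &, forall t t', d (c t) (c t') = `|t - t'|}].

Definition geodesic_segment (x y : T) (S : set T) : Prop :=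
  exists l c, geodesic_path x y l c /\ S = c @` `[0, l].

(* The addition of 'I_3 is modulo 3: the edge [e i] joins the vertices of
   indices i and i + 1, so that each pair of vertices is joined once. *)
Definition geodesic_triangle (v : 'I_3 -> T) (e : 'I_3 -> set T) : Prop :=
  forall i, geodesic_segment (v i) (v (i + 1)) (e i).

End geodesics.

(* Hyperboloid model: the upper sheet of <u|u> = -1 in R^3 for the form
   <u|v> = u_1 v_1 + u_2 v_2 - u_3 v_3, with cosh (d(u, v)) = - <u|v>. *)
Record hyperbolic_plane (R : realType) := HyperbolicPoint {
  hyp1 : R;
  hyp2 : R;
  hyp3 : R;
  hyp_sheet : hyp1 ^+ 2 + hyp2 ^+ 2 - hyp3 ^+ 2 = - 1;
  hyp_upper : 0 < hyp3
}.

Section model_plane.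
Context {R : realType}.
Implicit Types u v : hyperbolic_plane R.

Definition lorentz_form u v : R :=
  hyp1 u * hyp1 v + hyp2 u * hyp2 v - hyp3 u * hyp3 v.

Definition arcosh (x : R) : R := ln (x + Num.sqrt (x ^+ 2 - 1)).

Definition hyperbolic_dist u v : R := arcosh (- lorentz_form u v).

Definition model_dist (kappa : R) u v : R :=
  hyperbolic_dist u v / Num.sqrt (- kappa).

End model_plane.

Section metric_conditions.
Context {R : realType} (E : metricType R).

Definition complete_metric : Prop :=
  forall u : nat -> E, cauchy (u @ \oo) -> exists l : E, u @ \oo --> l.

Definition geodesic_space : Prop :=
  forall x y : E, exists l c, geodesic_path (@mdist R E) x y l c.

Definition convex_metric : Prop :=
  forall (x y1 y2 : E) (l1 l2 : R) (c1 c2 : R -> E),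
    geodesic_path (@mdist R E) x y1 l1 c1 ->
    geodesic_path (@mdist R E) x y2 l2 c2 ->
    forall t : R, 0 <= t <= 1 ->
      mdist (c1 (t * l1)) (c2 (t * l2)) <= t * mdist (c1 l1) (c2 l2).

Definition geodesic_extension : Prop :=
  forall (x y : E) (S : set E), geodesic_segment (@mdist R E) x y S ->
    exists2 g : R -> E,
      forall s t, mdist (g s) (g t) = `|s - t| & S `<=` range g.

(* [v], [e] is a triangle of E and [w], [f] a comparison triangle; [x'] and
   [y'] are the comparison points of [x] (on the edge i) and [y] (on the
   edge j). *)
Definition curvature_bounded_below (kappa : R) : Prop :=
  forall (v : 'I_3 -> E) (e : 'I_3 -> set E)
         (w : 'I_3 -> hyperbolic_plane R)
         (f : 'I_3 -> set (hyperbolic_plane R)),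
    geodesic_triangle (@mdist R E) v e ->
    geodesic_triangle (model_dist kappa) w f ->
    (forall i j, mdist (v i) (v j) = model_dist kappa (w i) (w j)) ->
    forall (i j : 'I_3) (x y : E) (x' y' : hyperbolic_plane R),
      e i x -> f i x' -> model_dist kappa x' (w i) = mdist x (v i) ->
      e j y -> f j y' -> model_dist kappa y' (w j) = mdist y (v j) ->
      model_dist kappa x' y' <= mdist x y.

Definition metric_bounded (X : set E) : Prop :=
  exists M : R, forall x y, X x -> X y -> mdist x y <= M.

Definition geodesically_convex (X : set E) : Prop :=
  forall (x y : E) (S : set E), X x -> X y ->
    geodesic_segment (@mdist R E) x y S -> S `<=` X.

Definition P_b_cl (X : set E) : Prop :=
  [/\ X !=set0, metric_bounded X & closed X].

Definition set_dist (z : E) (X : set E) : R := inf [set mdist z x | x in X].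

Definition hausdorff_dist (X Y : set E) : R :=
  Num.max (sup [set set_dist x Y | x in X]) (sup [set set_dist y X | y in Y]).

Definition max_dist (X Y : set E) : R :=
  sup [set mdist x y | x in X & y in Y].

Definition max_solution (X Y : set E) (p : E * E) : Prop :=
  [/\ X p.1, Y p.2 & mdist p.1 p.2 = max_dist X Y].

Definition maximizing_sequence (X Y : set E) (u : nat -> E * E) : Prop :=
  (forall n, X (u n).1 /\ Y (u n).2) /\
  mdist (u n).1 (u n).2 @[n --> \oo] --> max_dist X Y.

Definition max_well_posed (X Y : set E) : Prop :=
  exists p : E * E,
    [/\ max_solution X Y p,
        forall q, max_solution X Y q -> q = p &
        forall u, maximizing_sequence X Y u ->
          (u n).1 @[n --> \oo] --> p.1 /\ (u n).2 @[n --> \oo] --> p.2].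

End metric_conditions.

Record P_b_cl_cv (R : realType) (E : metricType R) := PbclcvSet {
  Pbclcv_set :> set E;
  Pbclcv_bcl : P_b_cl Pbclcv_set;
  Pbclcv_convex : geodesically_convex Pbclcv_set
}.

Section hausdorff_metric.
Context {R : realType} {E : metricType R}.
Implicit Types (x y z : E) (X Y Z : set E).

Lemma set_dist_lb z X : has_lbound [set mdist z x | x in X].
Proof. by exists 0 => _ [x _ <-]; exact: mdist_ge0. Qed.

Lemma set_dist_le z X x : X x -> set_dist z X <= mdist z x.
Proof. by move=> Xx; apply: ge_inf; [exact: set_dist_lb | exists x]. Qed.

Lemma set_dist_ge0 z X : X !=set0 -> 0 <= set_dist z X.
Proof.
move=> [x Xx]; apply: lb_le_inf; first by exists (mdist z x), x.
by move=> _ [y _ <-]; exact: mdist_ge0.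
Qed.

Lemma set_dist_lt z X (r : R) : X !=set0 -> set_dist z X < r ->
  exists2 x, X x & mdist z x < r.
Proof.
move=> [x Xx] zr; have hi : has_inf [set mdist z x | x in X].
  by split; [exists (mdist z x), x | exact: set_dist_lb].
have [|_ [y Xy <-]] := inf_adherent _ hi (eps := r - set_dist z X).
  by rewrite subr_gt0.
by rewrite -/(set_dist z X) subrKC => ?; exists y.
Qed.

Lemma set_dist_triangle z y X : X !=set0 ->
  set_dist z X <= mdist z y + set_dist y X.
Proof.
move=> X0; apply/ler_addgt0Pr => e e0.
have [|x Xx yx] := @set_dist_lt y X (set_dist y X + e) X0.
  by rewrite ltrDl.
rewrite (le_trans (set_dist_le z Xx))// (le_trans (metric_triangle z y x))//.
by rewrite -addrA lerD2l ltW.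
Qed.

Lemma set_dist_has_sup X Y : P_b_cl X -> P_b_cl Y ->
  has_sup [set set_dist x Y | x in X].
Proof.
move=> [[x0 Xx0] [M XM] _] [[y0 Yy0] _ _]; split.
  by exists (set_dist x0 Y), x0.
exists (M + mdist x0 y0) => _ [x Xx <-].
rewrite (le_trans (set_dist_le x Yy0))// (le_trans (metric_triangle x x0 y0))//.
by rewrite lerD2r XM.
Qed.

Lemma hausdorff_distP X Y (r : R) : P_b_cl X -> P_b_cl Y ->
  hausdorff_dist X Y <= r <->
  (forall x, X x -> set_dist x Y <= r) /\ (forall y, Y y -> set_dist y X <= r).
Proof.
move=> PX PY; have sXY := set_dist_has_sup PX PY.
have sYX := set_dist_has_sup PY PX; rewrite /hausdorff_dist ge_max; split.
  move=> /andP[XYr YXr]; split=> [x Xx|y Yy].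
    by apply: le_trans XYr; apply: ub_le_sup; [case: sXY | exists x].
  by apply: le_trans YXr; apply: ub_le_sup; [case: sYX | exists y].
move=> [XYr YXr]; apply/andP; split; apply: ge_sup.
- by case: sXY.
- by move=> _ [x Xx <-]; exact: XYr.
- by case: sYX.
- by move=> _ [y Yy <-]; exact: YXr.
Qed.

Lemma hausdorff_distC X Y : hausdorff_dist X Y = hausdorff_dist Y X.
Proof. by rewrite /hausdorff_dist maxC. Qed.

Lemma set_dist0 z X : closed X -> X !=set0 -> set_dist z X <= 0 -> X z.
Proof.
move=> cX X0 zX; apply: cX => B; rewrite -nbhs_ballE => -[r /= r0 zB].
have [|x Xx zx] := @set_dist_lt z X r X0; first exact: le_lt_trans r0.
by exists x; split=> //; apply: zB; rewrite ballEmdist.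
Qed.

Lemma set_dist_refl x X : X x -> set_dist x X = 0.
Proof.
move=> Xx; apply/eqP; rewrite eq_le set_dist_ge0 ?andbT; last by exists x.
by rewrite (le_trans (set_dist_le x Xx))// mdistxx.
Qed.

Lemma hausdorff_distxx X : P_b_cl X -> hausdorff_dist X X = 0.
Proof.
move=> PX; have [[x Xx] _ _] := PX; apply/eqP; rewrite eq_le; apply/andP; split.
  by apply/hausdorff_distP => //; split=> y /set_dist_refl ->.
have /(hausdorff_distP _ PX PX)[/(_ x Xx) + _] := lexx (hausdorff_dist X X).
by rewrite set_dist_refl.
Qed.

Lemma hausdorff_dist_eq0 X Y : P_b_cl X -> P_b_cl Y ->
  hausdorff_dist X Y = 0 -> X = Y.
Proof.
move=> PX PY h0; have [X0 _ cX] := PX; have [Y0 _ cY] := PY.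
have /(hausdorff_distP _ PX PY)[XY YX] : hausdorff_dist X Y <= 0 by rewrite h0.
by apply/seteqP; split=> z => [/XY|/YX]; exact: set_dist0.
Qed.

Lemma hausdorff_dist_triangle Y X Z : P_b_cl X -> P_b_cl Y -> P_b_cl Z ->
  hausdorff_dist X Z <= hausdorff_dist X Y + hausdorff_dist Y Z.
Proof.
move=> PX PY PZ.
have /(hausdorff_distP _ PX PY)[XY YX] := lexx (hausdorff_dist X Y).
have /(hausdorff_distP _ PY PZ)[YZ ZY] := lexx (hausdorff_dist Y Z).
have [X0 _ _] := PX; have [Y0 _ _] := PY; have [Z0 _ _] := PZ.
apply/hausdorff_distP => //; split=> [x Xx|z Zz]; apply/ler_addgt0Pr => e e0.
- have [|y Yy xy] := @set_dist_lt x Y (hausdorff_dist X Y + e) Y0.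
    by rewrite (le_lt_trans (XY _ Xx))// ltrDl.
  rewrite (le_trans (set_dist_triangle x y Z0))// addrAC.
  by apply: lerD; [exact: ltW | exact: YZ].
- have [|y Yy zy] := @set_dist_lt z Y (hausdorff_dist Y Z + e) Y0.
    by rewrite (le_lt_trans (ZY _ Zz))// ltrDl.
  rewrite (le_trans (set_dist_triangle z y X0))// -addrA addrC.
  by apply: lerD; [exact: ltW | exact: YX].
Qed.

End hausdorff_metric.

Section P_b_cl_cv_metric.
Context {R : realType} {E : metricType R}.
Implicit Types X Y Z : P_b_cl_cv E.

Let hdist X Y : R := hausdorff_dist X Y.

Let hdistxx X : hdist X X = 0.
Proof. exact/hausdorff_distxx/Pbclcv_bcl. Qed.

Let hdist_eq0 X Y : hdist X Y = 0 -> X = Y.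
Proof.
move=> /(hausdorff_dist_eq0 (Pbclcv_bcl X) (Pbclcv_bcl Y)).
case: X Y => [X PX cX] [Y PY cY] /= XY; move: PX cX; rewrite XY => PX cX.
by congr PbclcvSet; exact: Prop_irrelevance.
Qed.

Let hdistC X Y : hdist X Y = hdist Y X.
Proof. exact: hausdorff_distC. Qed.

Let hdist_triangle Y X Z : hdist X Z <= hdist X Y + hdist Y Z.
Proof. by apply: hausdorff_dist_triangle; exact: Pbclcv_bcl. Qed.

HB.instance Definition _ := gen_eqMixin (P_b_cl_cv E).
HB.instance Definition _ := gen_choiceMixin (P_b_cl_cv E).

HB.instance Definition _ := @isMetric.Build R (P_b_cl_cv E)
  hdist hdistxx hdist_eq0 hdistC hdist_triangle.

End P_b_cl_cv_metric.

Lemma mdist_P_b_cl_cv (R : realType) (E : metricType R) (X Y : P_b_cl_cv E) :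
  mdist X Y = hausdorff_dist X Y.
Proof. by []. Qed.

Definition W_max (R : realType) (E : metricType R) (A : set E) :
    set (P_b_cl_cv E) :=
  [set X : P_b_cl_cv E | max_well_posed A X].

(* Main.v *)
(* Write mu for the maximal distance between A and X. Near-maximizing pairs of
   max(A, X) having arbitrarily small diameter is an open condition at each scale,
   and well-posedness is the intersection of countably many of them. For density,
   prolong by t a nearly longest segment [a, x] to a point z and enlarge X by
   Y = {y | d(y, z) / D + d(y, X) / t <= 1}, a closed convex set as distances to
   points and to convex sets are convex. On Y the distance to A is at most
   mu + t - t d(y, z) / D, so near-maximizers (a', y) have y near z; then x is
   almost on a geodesic from z to a', and the curvature bound forces a' to be near
   a, as Stewart's formula in the hyperbolic comparison triangle shows. *)

Require Import Defs.
From mathcomp Require Import all_boot all_order all_algebra.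
From mathcomp Require Import all_classical all_reals all_analysis.
From mathcomp Require Import borel_hierarchy.
From mathcomp Require Import ring lra.

Set Implicit Arguments.
Unset Strict Implicit.
Unset Printing Implicit Defensive.

Import Order.TTheory GRing.Theory Num.Theory.
Import numFieldNormedType.Exports.

Local Open Scope classical_set_scope.
Local Open Scope ring_scope.

(** * Hyperbolic geometry *)

Section hyperbolic_functions.
Context {R : realType}.
Implicit Types x y l s t : R.

Definition cosh x : R := (expR x + expR (- x)) / 2.
Definition sinh x : R := (expR x - expR (- x)) / 2.

Lemma cosh0 : cosh 0 = 1.
Proof. by rewrite /cosh oppr0 expR0; field. Qed.

Lemma sinh0 : sinh 0 = 0.
Proof. by rewrite /sinh oppr0 subrr mul0r. Qed.

Lemma coshN x : cosh (- x) = cosh x.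
Proof. by rewrite /cosh opprK addrC. Qed.

Lemma sinhN x : sinh (- x) = - sinh x.
Proof. by rewrite /sinh opprK; field. Qed.

Lemma coshD x y : cosh (x + y) = cosh x * cosh y + sinh x * sinh y.
Proof. by rewrite /cosh /sinh opprD !expRD; field. Qed.

Lemma sinhD x y : sinh (x + y) = sinh x * cosh y + cosh x * sinh y.
Proof. by rewrite /cosh /sinh opprD !expRD; field. Qed.

Lemma coshB x y : cosh (x - y) = cosh x * cosh y - sinh x * sinh y.
Proof. by rewrite coshD coshN sinhN mulrN. Qed.

Lemma sinhB x y : sinh (x - y) = sinh x * cosh y - cosh x * sinh y.
Proof. by rewrite sinhD coshN sinhN mulrN. Qed.

Lemma cosh_sqr x : cosh x ^+ 2 = 1 + sinh x ^+ 2.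
Proof. by have := coshB x x; rewrite subrr cosh0 => ->; ring. Qed.

Lemma cosh_norm x : cosh `|x| = cosh x.
Proof. by case: (ger0P x) => // _; rewrite coshN. Qed.

Lemma sinh_gt0 x : 0 < x -> 0 < sinh x.
Proof. by move=> x0; rewrite divr_gt0// subr_gt0 ltr_expR; lra. Qed.

Lemma sinh_ge0 x : 0 <= x -> 0 <= sinh x.
Proof. by move=> x0; rewrite divr_ge0// subr_ge0 ler_expR; lra. Qed.

Lemma cosh_ge0 x : 0 <= cosh x.
Proof. by rewrite divr_ge0// addr_ge0// expR_ge0. Qed.

Lemma cosh_ge1 x : 1 <= cosh x.
Proof.
by rewrite -(@ler_pXn2r _ 2)// ?nnegrE ?cosh_ge0// cosh_sqr expr1n lerDl
  sqr_ge0.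
Qed.

Lemma sinhDcosh x : cosh x + sinh x = expR x.
Proof. by rewrite /cosh /sinh; field. Qed.

Lemma ltr_cosh x y : 0 <= x -> x < y -> cosh x < cosh y.
Proof.
move=> x0 xy; have -> : y = x + (y - x) by rewrite subrKC.
rewrite coshD; have := sinh_ge0 x0.
have : 0 < sinh (y - x) by apply: sinh_gt0; lra.
have : 1 < cosh (y - x); last by have := cosh_ge1 x; nra.
rewrite -(@ltr_pXn2r _ 2)// ?nnegrE ?cosh_ge0// cosh_sqr expr1n ltrDl.
by rewrite exprn_gt0// sinh_gt0// subr_gt0.
Qed.

Lemma ler_cosh x y : `|x| <= y -> cosh x <= cosh y.
Proof.
rewrite le_eqVlt -(cosh_norm x) => /orP[/eqP-> //|xy].
exact/ltW/ltr_cosh.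
Qed.

Lemma sinh_le_expR x : sinh x <= expR x.
Proof. by rewrite /sinh; have := expR_gt0 x; have := expR_gt0 (- x); lra. Qed.

Lemma cosh_le_expR x : 0 <= x -> cosh x <= expR x.
Proof.
move=> x0; have : expR (- x) <= expR x by rewrite ler_expR; lra.
by rewrite /cosh; have := expR_gt0 x; lra.
Qed.

(** Turns an additive error [e] in a length into the factor [expR e], the form in which almost equal
    lengths enter Stewart's formula. *)
Lemma cosh_le_mul x y (e : R) : `|x - y| <= e -> cosh x <= expR e * cosh y.
Proof.
rewrite ler_norml => /andP[yx xy]; rewrite /cosh mulrA mulrDr -!expRD.
by rewrite ler_pM2r// lerD// ler_expR; lra.
Qed.

Lemma arcosh_cosh x : 0 <= x -> arcosh (cosh x) = x.
Proof.
move=> x0; rewrite /arcosh cosh_sqr addrAC subrr add0r sqrtr_sqr.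
by rewrite ger0_norm ?sinh_ge0// sinhDcosh expRK.
Qed.

Lemma arcoshK x : 1 <= x -> cosh (arcosh x) = x.
Proof.
move=> x1; rewrite /arcosh; set w := Num.sqrt _.
have w0 : 0 <= w by exact: sqrtr_ge0.
have w2 : w ^+ 2 = x ^+ 2 - 1 by rewrite sqr_sqrtr//; nra.
have xw : 0 < x + w by lra.
rewrite /cosh expRN lnK ?posrE//.
have -> : (x + w)^-1 = x - w.
  by apply: (mulfI (lt0r_neq0 xw)); rewrite divff ?lt0r_neq0//; ring: w2.
by field.
Qed.

Lemma arcosh_ge0 x : 1 <= x -> 0 <= arcosh x.
Proof. by move=> x1; rewrite ln_ge0// -[1]addr0 lerD// sqrtr_ge0. Qed.

End hyperbolic_functions.

(** * Geodesics and triangles in the hyperboloid model *)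

Section hyperboloid.
Context {R : realType}.
Implicit Types u v w : hyperbolic_plane R.

Lemma lorentz_formC u v : lorentz_form u v = lorentz_form v u.
Proof. by rewrite /lorentz_form; ring. Qed.

Lemma lorentz_form_refl u : lorentz_form u u = - 1.
Proof. by have := hyp_sheet u; rewrite /lorentz_form !expr2. Qed.

(** Reversed Cauchy-Schwarz inequality: after squaring, the difference of the two sides is a sum of
    three squares. It keeps the argument of [arcosh] in the range where [cosh] inverts it. *)
Lemma lorentz_form_ge1 u v : 1 <= - lorentz_form u v.
Proof.
case: u v => [u1 u2 u3 hu u0] [v1 v2 v3 hv v0]; rewrite /lorentz_form/=.
have : 1 + u1 * v1 + u2 * v2 <= u3 * v3.
  have [?|n0] := ltP (1 + u1 * v1 + u2 * v2) 0;
    first by have := mulr_gt0 u0 v0; lra.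
  rewrite -(@ler_pXn2r _ 2)// ?nnegrE ?mulr_ge0 ?(ltW u0) ?(ltW v0)//.
  have -> : (u3 * v3) ^+ 2 = (1 + u1 ^+ 2 + u2 ^+ 2) * (1 + v1 ^+ 2 + v2 ^+ 2).
    rewrite exprMn (_ : u3 ^+ 2 = 1 + u1 ^+ 2 + u2 ^+ 2); last by lra.
    by rewrite (_ : v3 ^+ 2 = 1 + v1 ^+ 2 + v2 ^+ 2); last by lra.
  rewrite -subr_ge0 (_ : _ - _ = (u1 - v1) ^+ 2 + (u2 - v2) ^+ 2 +
    (u1 * v2 - u2 * v1) ^+ 2); last by ring.
  by rewrite !addr_ge0 ?sqr_ge0.
by lra.
Qed.

Lemma hyperbolic_plane_eq u v : hyp1 u = hyp1 v -> hyp2 u = hyp2 v ->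
  hyp3 u = hyp3 v -> u = v.
Proof.
case: u v => [u1 u2 u3 hu uu] [v1 v2 v3 hv vv] /= e1 e2 e3.
by subst; congr HyperbolicPoint; exact: Prop_irrelevance.
Qed.

(** The path is the linear combination of [u] and [w] with weights [sinh (l - s) / sinh l] and
    [sinh s / sinh l]; the addition formulas keep it on the hyperboloid. Linearity gives the last
    clause, which is Stewart's formula when [v] is the third vertex of a triangle. *)
Lemma hyperbolic_geodesic u w (l : R) : 0 < l -> - lorentz_form u w = cosh l ->
  exists c : R -> hyperbolic_plane R, [/\ c 0 = u, c l = w,
    {in `[0, l] &, forall s t, - lorentz_form (c s) (c t) = cosh (s - t)} &
    {in `[0, l], forall s v, sinh l * lorentz_form (c s) v =
      sinh (l - s) * lorentz_form u v + sinh s * lorentz_form w v}].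
Proof.
move=> l0 uw; have sl := sinh_gt0 l0; have sl0 := lt0r_neq0 sl.
pose co (h : hyperbolic_plane R -> R) s :=
  (sinh (l - s) * h u + sinh s * h w) / sinh l.
have formE s t : co (@hyp1 R) s * co (@hyp1 R) t + co (@hyp2 R) s * co (@hyp2 R) t
    - co (@hyp3 R) s * co (@hyp3 R) t = - cosh (s - t).
  transitivity ((sinh (l - s) * sinh (l - t) * lorentz_form u u +
     sinh s * sinh t * lorentz_form w w + (sinh (l - s) * sinh t +
     sinh s * sinh (l - t)) * lorentz_form u w) / sinh l ^+ 2).
    by rewrite /co /lorentz_form; field.
  rewrite !lorentz_form_refl (_ : lorentz_form u w = - cosh l); last first.
    by rewrite -uw opprK.
  have := cosh_sqr l; rewrite !sinhB coshB => cl.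
  apply: (mulIf (expf_neq0 2 sl0)); rewrite divfK ?expf_neq0//.
  have es : sinh l ^+ 2 = cosh l ^+ 2 - 1 by rewrite cl; ring.
  ring: es.
(* [choice] needs a point for every [s]. The third coordinate is shown positive on [[0, l]], where
   both weights are nonnegative; elsewhere [u] is a default value. *)
have pt s : exists c, s \in `[0, l] -> [/\ hyp1 c = co (@hyp1 R) s,
    hyp2 c = co (@hyp2 R) s & hyp3 c = co (@hyp3 R) s].
  have [sl'|_] := boolP (s \in `[0, l]); last by exists u.
  move: sl'; rewrite in_itv/= => /andP[s0 sl'].
  have sheet :
      co (@hyp1 R) s ^+ 2 + co (@hyp2 R) s ^+ 2 - co (@hyp3 R) s ^+ 2 = - 1.
    by have := formE s s; rewrite subrr cosh0 -!expr2.
  have upper : 0 < co (@hyp3 R) s.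
    have u3 := hyp_upper u; have w3 := hyp_upper w.
    apply: divr_gt0 => //; have [->|s1] := eqVneq s 0.
      by rewrite subr0 sinh0 mul0r addr0 mulr_gt0.
    have : 0 < sinh s by rewrite sinh_gt0// lt_neqAle eq_sym s1.
    have : 0 <= sinh (l - s) by rewrite sinh_ge0// subr_ge0.
    by nra.
  by exists (HyperbolicPoint sheet upper).
have [c cE] := choice pt; exists c.
have i0 : 0 \in `[0, l] by rewrite in_itv/= lexx ltW.
have il : l \in `[0, l] by rewrite in_itv/= lexx ltW.
split.
- have [c1 c2 c3] := cE _ i0; apply: hyperbolic_plane_eq;
    by rewrite ?c1 ?c2 ?c3 /co subr0 sinh0 mul0r addr0 mulrC mulKf.
- have [c1 c2 c3] := cE _ il; apply: hyperbolic_plane_eq;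
    by rewrite ?c1 ?c2 ?c3 /co subrr sinh0 mul0r add0r mulrC mulKf.
- move=> s t /cE[s1 s2 s3] /cE[t1 t2 t3].
  by rewrite /lorentz_form s1 s2 s3 t1 t2 t3 formE opprK.
- by move=> s /cE[s1 s2 s3] v; rewrite /lorentz_form s1 s2 s3 /co; field.
Qed.

(** [w0] is the point (0, 0, 1), [w1] lies above the first axis, and [w2] lies in the direction
    whose cosine [C] is prescribed by the hyperbolic law of cosines. The triangle inequalities
    amount to [-1 <= C <= 1]. *)
Lemma hyperbolic_triangle (p q r : R) : 0 < p -> 0 < q -> 0 < r ->
  p <= q + r -> q <= p + r -> r <= p + q ->
  exists w0 w1 w2 : hyperbolic_plane R, [/\ - lorentz_form w0 w1 = cosh p,
    - lorentz_form w1 w2 = cosh r & - lorentz_form w2 w0 = cosh q].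
Proof.
move=> p0 q0 r0 pqr qpr rpq.
have sp := sinh_gt0 p0; have sq := sinh_gt0 q0.
have spq : 0 < sinh p * sinh q by exact: mulr_gt0.
pose C := (cosh p * cosh q - cosh r) / (sinh p * sinh q).
have C1 : C <= 1.
  rewrite ler_pdivrMr// mul1r; have : cosh (p - q) <= cosh r.
    by apply: ler_cosh; rewrite ler_norml; lra.
  by rewrite coshB; lra.
have C2 : -1 <= C.
  rewrite ler_pdivlMr// mulN1r; have : cosh r <= cosh (p + q).
    by apply: ler_cosh; rewrite ger0_norm//; lra.
  by rewrite coshD; lra.
have D2 : Num.sqrt (1 - C ^+ 2) ^+ 2 = 1 - C ^+ 2.
  by rewrite sqr_sqrtr// subr_ge0; nra.
have h0 : (0 : R) ^+ 2 + 0 ^+ 2 - 1 ^+ 2 = - 1 by ring.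
have h1 : sinh p ^+ 2 + 0 ^+ 2 - cosh p ^+ 2 = - 1 by rewrite cosh_sqr; ring.
have h2 :
    (sinh q * C) ^+ 2 + (sinh q * Num.sqrt (1 - C ^+ 2)) ^+ 2 - cosh q ^+ 2 = - 1.
  have -> : cosh q ^+ 2 = 1 + sinh q ^+ 2 := cosh_sqr q.
  by ring: D2.
have cp : 0 < cosh p by apply: lt_le_trans (cosh_ge1 p).
have cq : 0 < cosh q by apply: lt_le_trans (cosh_ge1 q).
exists (HyperbolicPoint h0 ltr01), (HyperbolicPoint h1 cp),
  (HyperbolicPoint h2 cq).
rewrite /lorentz_form/=; split; [by ring| |by ring].
by rewrite /C; field; rewrite !lt0r_neq0.
Qed.

End hyperboloid.

(** * Comparison with the hyperbolic plane *)

Section comparison.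
Context {R : realType} (kappa : R).
Hypothesis kappa_lt0 : kappa < 0.
Let k := Num.sqrt (- kappa).

Let k_gt0 : 0 < k. Proof. by rewrite sqrtr_gt0 oppr_gt0. Qed.

Lemma model_dist_cosh (u v : hyperbolic_plane R) s : 0 <= s ->
  - lorentz_form u v = cosh (k * s) -> model_dist kappa u v = s.
Proof.
move=> s0 uv; rewrite /model_dist /hyperbolic_dist uv arcosh_cosh.
  by rewrite -/k mulrC mulKf ?lt0r_neq0.
by rewrite mulr_ge0// ltW.
Qed.

Lemma cosh_model_dist (u v : hyperbolic_plane R) :
  cosh (k * model_dist kappa u v) = - lorentz_form u v.
Proof.
rewrite /model_dist -/k mulrC divfK ?lt0r_neq0// arcoshK//.
exact: lorentz_form_ge1.
Qed.

Lemma model_dist_ge0 (u v : hyperbolic_plane R) : 0 <= model_dist kappa u v.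
Proof.
by rewrite divr_ge0 ?sqrtr_ge0// arcosh_ge0// lorentz_form_ge1.
Qed.

Lemma model_geodesic (u w : hyperbolic_plane R) l : 0 < l ->
  - lorentz_form u w = cosh (k * l) ->
  exists c, geodesic_path (model_dist kappa) u w l c /\
    {in `[0, l], forall s v, sinh (k * l) * lorentz_form (c s) v =
      sinh (k * (l - s)) * lorentz_form u v + sinh (k * s) * lorentz_form w v}.
Proof.
move=> l0 /(hyperbolic_geodesic (mulr_gt0 k_gt0 l0))[c [c0 cl cE cv]].
have I s : s \in `[0, l] -> k * s \in `[0, k * l].
  rewrite !in_itv/= => /andP[s0 sl].
  by rewrite mulr_ge0 ?(ltW k_gt0)//= ler_wpM2l// ltW.
exists (fun s => c (k * s)); split.
  split; [exact: ltW|by rewrite mulr0|exact: cl|].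
  move=> s t /I ks /I kt; apply: model_dist_cosh; first exact: normr_ge0.
  by rewrite cE// -mulrBr -[RHS]cosh_norm -[LHS]cosh_norm !normrM normr_id.
by move=> s /I ks v; rewrite (mulrBr k) cv.
Qed.

Definition triple {T : Type} (a b c : T) (i : 'I_3) : T :=
  match val i with 0 => a | 1 => b | _ => c end.

Variable E : metricType R.
Implicit Types x y z a : E.

(* Stewart's formula in the comparison triangle, which is an equality there. *)
Lemma stewart_le z a a' x S : geodesic_space E ->
  curvature_bounded_below E kappa ->
  geodesic_segment (@mdist R E) z a S -> S x ->
  z != a -> z != a' -> a != a' ->
  sinh (k * (mdist z a - mdist z x)) * cosh (k * mdist z a') +
    sinh (k * mdist z x) * cosh (k * mdist a a') <=
  sinh (k * mdist z a) * cosh (k * mdist x a').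
Proof.
move=> geoE curv segS Sx.
have [l [c [cP SE]]] := segS; move: Sx; rewrite SE => -[s sl xE].
have [l0 c0 cl cd] := cP.
have i0 : 0 \in `[0, l] by rewrite in_itv/= lexx.
have il : l \in `[0, l] by rewrite in_itv/= lexx andbT.
have [s0 sl'] : 0 <= s /\ s <= l by move: sl => /=; rewrite in_itv/= => /andP.
have zx : mdist z x = s by rewrite -c0 -xE cd// sub0r normrN ger0_norm.
have za : mdist z a = l by rewrite -c0 -cl cd// sub0r normrN ger0_norm.
rewrite -!mdist_gt0 => za0 za'0 aa'0.
have kE p : 0 < p -> 0 < k * p by exact: mulr_gt0.
have kD p q r : p <= q + r -> k * p <= k * q + k * r.
  by rewrite -mulrDr ler_pM2l.
have [||| w0 [w1 [w2 [w01 w12 w20]]]] :=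
    hyperbolic_triangle (kE _ za0) (kE _ za'0) (kE _ aa'0).
- by apply: kD; rewrite (metric_sym a) metric_triangle.
- by apply: kD; rewrite metric_triangle.
- by apply: kD; rewrite (metric_sym z a) metric_triangle.
have [f0 [f0P f0v]] := model_geodesic za0 w01.
have [f1 [f1P _]] := model_geodesic aa'0 w12.
have [f2 [f2P _]] := model_geodesic za'0 w20.
have [l1 [c1 c1P]] := geoE a a'; have [l2 [c2 c2P]] := geoE a' z.
pose e := triple S (c1 @` `[0, l1]) (c2 @` `[0, l2]).
pose f := triple (f0 @` `[0, mdist z a]) (f1 @` `[0, mdist a a'])
  (f2 @` `[0, mdist z a']).
have vE : geodesic_triangle (@mdist R E) (triple z a a') e.
  move=> -[[|[|[|]]] ?] //; [by exists l1, c1|by exists l2, c2].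
have wE : geodesic_triangle (model_dist kappa) (triple w0 w1 w2) f.
  move=> -[[|[|[|]]] ?] //; [by exists (mdist z a), f0|
    by exists (mdist a a'), f1|by exists (mdist z a'), f2].
have d0 w : model_dist kappa w w = 0.
  by apply: model_dist_cosh => //; rewrite mulr0 cosh0 lorentz_form_refl opprK.
have dC u w : model_dist kappa u w = model_dist kappa w u.
  by rewrite /model_dist /hyperbolic_dist lorentz_formC.
have d01 : mdist z a = model_dist kappa w0 w1.
  by rewrite (model_dist_cosh _ w01)// ltW.
have d12 : mdist a a' = model_dist kappa w1 w2.
  by rewrite (model_dist_cosh _ w12)// ltW.
have d20 : mdist z a' = model_dist kappa w2 w0.
  by rewrite (model_dist_cosh _ w20)// ltW.
have vw i j : mdist (triple z a a' i) (triple z a a' j) =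
    model_dist kappa (triple w0 w1 w2 i) (triple w0 w1 w2 j).
  case: i => [[|[|[|i]]] hi] //; case: j => [[|[|[|j]]] hj] //;
    rewrite /triple/= ?d0 ?mdistxx //.
  - by rewrite dC.
  - by rewrite metric_sym dC.
  - by rewrite metric_sym.
  - by rewrite metric_sym dC.
have [_ f00 _ f0d] := f0P; have [_ f20 _ _] := f2P.
have sI : s \in `[0, mdist z a] by rewrite za.
have i0' : 0 \in `[0, mdist z a] by rewrite za.
have le_x : model_dist kappa (f0 s) w2 <= mdist x a'.
  (* [x] is on edge 0, from [z] to [a]. The point [a'] is the start of edge 2, from [a'] to [z], so
     it and its comparison point [w2] have parameter 0. *)
  apply: (curv _ _ _ _ vE wE vw ord0 ord_max x a' (f0 s) w2).
  - by rewrite /e /triple/= SE; exists s.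
  - by exists s.
  - by rewrite /triple/= -[w0]f00 f0d// subr0 metric_sym zx ger0_norm.
  - have [l20 c20 _ _] := c2P.
    by exists 0; rewrite //= in_itv/= lexx.
  - by exists 0; rewrite //= in_itv/= lexx ltW.
  - by rewrite /triple/= d0 mdistxx.
have {}le_x : - lorentz_form (f0 s) w2 <= cosh (k * mdist x a').
  rewrite -cosh_model_dist ler_cosh// ger0_norm ?ler_pM2l//.
  by rewrite mulr_ge0 ?model_dist_ge0// ltW.
have := f0v s sI w2; rewrite zx -w12 -w20 (lorentz_formC w2) => fs.
rewrite !mulrN -opprD -fs -mulrN ler_pM2l// sinh_gt0// mulr_gt0//.
Qed.

End comparison.

Section nonbranching.
Context {R : realType} (kappa : R) (E : metricType R).
Hypothesis kappa_lt0 : kappa < 0.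
Let k := Num.sqrt (- kappa).

(* Geodesics do not branch: an almost geodesic continuation of [z, x] of almost
   the same length as [z, a] ends near a. *)
Lemma nonbranching : geodesic_space E -> curvature_bounded_below E kappa ->
  forall t M e : R, 0 < t -> 0 < e -> exists2 eta : R, 0 < eta &
  forall (z a a' x : E) S, geodesic_segment (@mdist R E) z a S -> S x ->
    mdist z x = t -> mdist x a = mdist z a - t -> mdist z a <= M ->
    mdist z a <= mdist z a' + eta ->
    mdist x a' <= mdist x a + eta -> mdist a a' <= e.
Proof.
move=> geoE curv t M e t0 e0.
have k0 : 0 < k by rewrite sqrtr_gt0 oppr_gt0.
pose B := expR (k * M); have B0 : 0 < B by exact: expR_gt0.
have st0 : 0 < sinh (k * t) by rewrite sinh_gt0// mulr_gt0.
have ce1 : 1 < cosh (k * e) by rewrite -[1]cosh0 ltr_cosh// mulr_gt0.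
(* At the end, a gain above [sinh (k * t) * (cosh (k * e) - 1)] meets an error of at most
   [delta * (2 * B ^+ 2)]; this [delta] makes the two quantities equal. *)
pose delta := sinh (k * t) * (cosh (k * e) - 1) / (2 * B ^+ 2).
have delta0 : 0 < delta.
  apply: divr_gt0; apply: mulr_gt0 => //; first by rewrite subr_gt0.
  exact: exprn_gt0.
(* The bound [t / 2] keeps [a'] away from [z], as [t <= mdist z a]; the other bound makes
   [expR (k * eta)] at most [1 + delta]. *)
pose eta := Num.min (t / 2) (ln (1 + delta) / k).
have eta0 : 0 < eta.
  by rewrite lt_min; apply/andP; split; apply: divr_gt0 => //;
    rewrite ln_gt0 ?ltrDl.
exists eta => // z a a' x S segS Sx zx xa zaM zaa' xaa'.
have etat : eta <= t / 2 by rewrite ge_min lexx.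
have eketa : expR (k * eta) <= 1 + delta.
  rewrite -[1 + delta]lnK ?posrE ?addr_gt0// ler_expR mulrC -ler_pdivlMr//.
  by rewrite ge_min lexx orbT.
rewrite leNgt; apply/negP => eaa'.
have pt : t <= mdist z a by rewrite -subr_ge0 -xa mdist_ge0.
have za : z != a by rewrite -mdist_gt0; apply: lt_le_trans pt.
have za' : z != a' by rewrite -mdist_gt0; lra.
have aa' : a != a' by rewrite -mdist_gt0; lra.
have := stewart_le kappa_lt0 geoE curv segS Sx za za' aa'.
rewrite -/k zx.
set p := mdist z a in za xa zaM zaa' pt *; set q := mdist z a' in zaa' *.
set r := mdist a a' in eaa' *; set s := mdist x a' in xaa' *.
have qts : q <= t + s by rewrite -zx metric_triangle.
have T0 : 1 < 1 + delta by rewrite ltrDl.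
have c1 : cosh (k * s) <= (1 + delta) * cosh (k * (p - t)).
  have [sp|ps] := leP s (p - t).
    have : cosh (k * s) <= cosh (k * (p - t)).
      rewrite ler_cosh// ger0_norm ?mulr_ge0 ?(ltW k0) ?mdist_ge0//.
      by rewrite ler_pM2l.
    by have := cosh_ge0 (k * (p - t)); nra.
  apply: (@le_trans _ _ (expR (k * eta) * cosh (k * (p - t)))).
    apply: cosh_le_mul; rewrite -mulrBr normrM gtr0_norm// ler_pM2l//.
    by rewrite ger0_norm; lra.
  by rewrite ler_wpM2r ?cosh_ge0.
have c2 : cosh (k * p) <= (1 + delta) * cosh (k * q).
  have [pq|qp] := leP p q.
    have : cosh (k * p) <= cosh (k * q).
      by rewrite ler_cosh// ger0_norm ?mulr_ge0 ?(ltW k0) ?mdist_ge0 ?ler_pM2l.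
    by have := cosh_ge0 (k * q); nra.
  apply: (@le_trans _ _ (expR (k * eta) * cosh (k * q))).
    apply: cosh_le_mul; rewrite -mulrBr normrM gtr0_norm// ler_pM2l//.
    by rewrite ger0_norm; lra.
  by rewrite ler_wpM2r ?cosh_ge0.
have c3 : cosh (k * e) < cosh (k * r).
  by rewrite ltr_cosh ?mulr_ge0 ?ltr_pM2l// ltW.
have kp0 : 0 <= k * (p - t) by rewrite mulr_ge0 ?subr_ge0// ltW.
have kp1 : k * (p - t) <= k * M by rewrite ler_pM2l//; lra.
have kp2 : k * p <= k * M by rewrite ler_pM2l.
have kp3 : 0 <= k * p by rewrite mulr_ge0 ?mdist_ge0 ?ltW.
have id : sinh (k * t) = sinh (k * p) * cosh (k * (p - t)) -
    cosh (k * p) * sinh (k * (p - t)).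
  by rewrite -sinhB; congr sinh; ring.
have bs u : 0 <= u -> u <= k * M -> 0 <= sinh u <= B.
  move=> u0 uM; rewrite sinh_ge0//= (le_trans (sinh_le_expR u))//.
  by rewrite ler_expR.
have bc u : 0 <= u -> u <= k * M -> 0 <= cosh u <= B.
  move=> u0 uM; rewrite cosh_ge0//= (le_trans (cosh_le_expR u0))//.
  by rewrite ler_expR.
have dE : delta * (2 * B ^+ 2) = sinh (k * t) * (cosh (k * e) - 1).
  by rewrite divfK// mulf_neq0 ?expf_neq0 ?lt0r_neq0.
have /andP[s1 s2] := bs _ kp3 kp2; have /andP[s3 s4] := bs _ kp0 kp1.
have /andP[d1 d2] := bc _ kp3 kp2; have /andP[d3 d4] := bc _ kp0 kp1.
have := cosh_ge0 (k * q); clearbody delta B => {bs bc}.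
set sp := sinh (k * p) in id s1 s2 *.
set spt := sinh (k * (p - t)) in id s3 s4 *.
set cp := cosh (k * p) in c2 d1 d2 id *.
set cpt := cosh (k * (p - t)) in d3 d4 c1 id *.
move=> q0 main.
(* This follows from [c2] because [(1 - delta) * (1 + delta) <= 1]; for [delta > 1] the left side is
   nonpositive. *)
have q1 : (1 - delta) * cp <= cosh (k * q).
  by have [d|d] := leP delta 1; nra.
have m1 : spt * ((1 - delta) * cp) <= spt * cosh (k * q) by exact: ler_wpM2l.
have m2 : sp * cosh (k * s) <= sp * ((1 + delta) * cpt) by exact: ler_wpM2l.
have m3 : sp * cpt <= B ^+ 2 by rewrite expr2 ler_pM.
have m4 : spt * cp <= B ^+ 2 by rewrite expr2 ler_pM.
have m5 : sinh (k * t) * cosh (k * e) < sinh (k * t) * cosh (k * r).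
  by rewrite ltr_pM2l.
have m6 : delta * (sp * cpt + spt * cp) <= delta * (2 * B ^+ 2).
  by rewrite ler_pM2l//; lra.
have : spt * ((1 - delta) * cp) + sinh (k * t) * cosh (k * e) <
  sp * ((1 + delta) * cpt) by lra.
(* Expanding [sinh (k * t)] by [id] cancels the main terms and leaves only those carrying
   [delta]. *)
have -> : sp * ((1 + delta) * cpt) = spt * ((1 - delta) * cp) + sinh (k * t) +
   delta * (sp * cpt + spt * cp) by rewrite id; ring.
by lra.
Qed.

End nonbranching.

(** * Convex metrics *)

Section metric_geometry.
Context {R : realType} (E : metricType R).
Implicit Types (x y z : E) (X Y : set E).

Lemma geodesic_rev x y l c : geodesic_path (@mdist R E) x y l c ->
  geodesic_path (@mdist R E) y x l (fun s => c (l - s)).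
Proof.
move=> [l0 cx cy cd]; split; rewrite ?subr0 ?subrr// => s t.
rewrite !in_itv/= => /andP[s0 sl] /andP[t0 tl].
rewrite cd ?in_itv/= ?subr_ge0 ?gerBl ?sl ?tl//.
by rewrite opprB addrC subrKA distrC.
Qed.

(** The segment from [a] to [x] lies on a line of E, and [z] is reached by following this line for a
    further length [t] beyond [x]. *)
Lemma geodesic_extend (a x : E) (t : R) :
  geodesic_space E -> geodesic_extension E -> 0 <= t ->
  exists z S, [/\ geodesic_segment (@mdist R E) z a S, S x, mdist z x = t &
    mdist x a = mdist z a - t].
Proof.
move=> geoE ext t0.
(* One orientation suffices: a line that meets [x] before [a] is traversed backwards by
   [g \o -%R]. *)
suff line (g : R -> E) sa sx : (forall s s', mdist (g s) (g s') = `|s - s'|) ->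
    sa <= sx -> exists z S, [/\ geodesic_segment (@mdist R E) z (g sa) S,
      S (g sx), mdist z (g sx) = t & mdist (g sx) (g sa) = mdist z (g sa) - t].
  have [l [c cP]] := geoE a x; have [l0 c0 cl cd] := cP.
  have [|g gd cg] := ext a x (c @` `[0, l]); first by exists l, c.
  have [|sa _ gsa] := cg a; first by exists 0; rewrite //= in_itv/= lexx.
  have [|sx _ gsx] := cg x; first by exists l; rewrite //= in_itv/= lexx andbT.
  have [le|/ltW le] := leP sa sx; first by rewrite -gsa -gsx; exact: line.
  have := line (g \o -%R) (- sa) (- sx); rewrite /= !opprK gsa gsx; apply.
    by move=> s s'; rewrite gd -opprD normrN.
  by rewrite lerN2.
move=> gd le.
exists (g (sx + t)), [set g (sx + t - s) | s in `[0, sx + t - sa]].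
split.
- exists (sx + t - sa), (fun s => g (sx + t - s)); split=> //.
  split; [by lra|by rewrite subr0|by rewrite subKr|].
  by move=> s s' _ _; rewrite gd distrC; congr `|_|; ring.
- by exists t; rewrite ?addrK//= in_itv/= t0; lra.
- by rewrite gd addrAC subrr add0r ger0_norm.
- by rewrite !gd !ger0_norm; lra.
Qed.

Lemma closed_sublevel (f : E -> R) (K r : R) :
  (forall x y, f x <= f y + K * mdist x y) -> closed [set y | f y <= r].
Proof.
move=> fK y cly /=; rewrite leNgt; apply/negP => ry.
(* [K] has no prescribed sign, so [|K| + 1] serves as a positive Lipschitz constant. *)
have K1 : 0 < `|K| + 1 by rewrite ltr_wpDl.
have d0 : 0 < (f y - r) / (`|K| + 1) by rewrite divr_gt0// subr_gt0.
have [x [/= xr]] := cly _ (nbhsx_ballx y _ d0).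
rewrite ballEmdist/= ltr_pdivlMr// => yx.
have := fK y x; have := ler_norm K; have := mdist_ge0 y x; nra.
Qed.

Definition convex_along_geodesics (f : E -> R) := forall x y l c,
  geodesic_path (@mdist R E) x y l c -> forall t, 0 <= t <= 1 ->
  f (c (t * l)) <= (1 - t) * f x + t * f y.

Lemma geodesically_convex_sublevel f (r : R) : convex_along_geodesics f ->
  geodesically_convex [set y | f y <= r].
Proof.
move=> fcv x y S /= fx fy [l [c [cP ->]]] _ /= [s /= + <-].
have [l0 c0 cl _] := cP; rewrite in_itv/= => /andP[s0 sl].
have [l00|l1] := eqVneq l 0.
  by rewrite (_ : s = 0) ?c0//; lra.
have l_gt0 : 0 < l by rewrite lt_neqAle eq_sym l1.
have t01 : 0 <= s / l <= 1.
  by rewrite divr_ge0//= ler_pdivrMr// mul1r.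
have := fcv _ _ _ _ cP _ t01; rewrite divfK//.
move/le_trans; apply; case/andP: t01 => ? ?; nra.
Qed.

Hypotheses (geoE : geodesic_space E) (cvE : convex_metric E).

(** [convex_metric] only compares geodesics with a common origin. The diagonal from [x] to [y'] is
    inserted: it is compared with [c] from [x], and its reverse with the reverse of [c'] from
    [y']. *)
Lemma mdist_geodesics x y x' y' l l' c c' (t : R) :
  geodesic_path (@mdist R E) x y l c ->
  geodesic_path (@mdist R E) x' y' l' c' -> 0 <= t <= 1 ->
  mdist (c (t * l)) (c' (t * l')) <= (1 - t) * mdist x x' + t * mdist y y'.
Proof.
move=> cP cP' t01; have [l2 [c2 cP2]] := geoE x y'.
have t01' : 0 <= 1 - t <= 1 by lra.
have [_ _ cl _] := cP; have [_ c0' _ _] := cP'; have [_ c20 c2l _] := cP2.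
have := cvE cP cP2 t01; rewrite cl c2l => h1.
have := cvE (geodesic_rev cP2) (geodesic_rev cP') t01'.
rewrite !subrr c20 c0' !mulrBl !mul1r !subKr => h2.
by have := metric_triangle (c (t * l)) (c2 (t * l2)) (c' (t * l')); lra.
Qed.

(** The point [z] is treated as a constant geodesic of length 0. *)
Lemma convex_mdist z : convex_along_geodesics (mdist^~ z).
Proof.
move=> x y l c cP t t01.
have zP : geodesic_path (@mdist R E) z z 0 (fun=> z).
  split=> // s s'; rewrite !in_itv/= => ? ?.
  by rewrite mdistxx (_ : s - s' = 0) ?normr0//; lra.
exact: (mdist_geodesics cP zP t01).
Qed.

(** Nearly closest points of [X] to [x] and to [y] are joined by a geodesic, which stays in [X] by
    convexity and is compared with [c]. *)
Lemma convex_set_dist X : X !=set0 -> geodesically_convex X ->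
  convex_along_geodesics (fun x => set_dist x X).
Proof.
move=> X0 Xcv x y l c cP t t01; apply/ler_addgt0Pr => e e0.
have [|x' Xx' xx'] := @set_dist_lt _ E x X (set_dist x X + e) X0.
  by rewrite ltrDl.
have [|y' Xy' yy'] := @set_dist_lt _ E y X (set_dist y X + e) X0.
  by rewrite ltrDl.
have [l' [c' cP']] := geoE x' y'.
have [l0' _ _ _] := cP'.
have Xc : X (c' (t * l')).
  apply: (Xcv _ _ (c' @` `[0, l']) Xx' Xy'); first by exists l', c'.
  by exists (t * l') => //=; rewrite in_itv/=; nra.
have := set_dist_le (c (t * l)) Xc.
have := mdist_geodesics cP cP' t01; nra.
Qed.

End metric_geometry.

(** * The maximization problem *)

Section max_problem.
Context {R : realType} (E : metricType R).
Implicit Types (x y z : E) (X Y A : set E).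

Lemma max_dist_has_sup A X : P_b_cl A -> P_b_cl X ->
  has_sup [set mdist x y | x in A & y in X].
Proof.
move=> [[a0 Aa0] [M AM] _] [[x0 Xx0] [N XN] _]; split.
  by exists (mdist a0 x0), a0 => //; exists x0.
exists (M + mdist a0 x0 + N) => _ [a Aa [x Xx <-]].
have := metric_triangle a a0 x; have := metric_triangle a0 x0 x.
by have := AM _ _ Aa Aa0; have := XN _ _ Xx0 Xx; lra.
Qed.

Lemma max_dist_ge A X a x : P_b_cl A -> P_b_cl X -> A a -> X x ->
  mdist a x <= max_dist A X.
Proof.
move=> PA PX Aa Xx; apply: ub_le_sup; first by case: (max_dist_has_sup PA PX).
by exists a => //; exists x.
Qed.

Lemma max_dist_adherent A X (e : R) : P_b_cl A -> P_b_cl X -> 0 < e ->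
  exists a x, [/\ A a, X x & max_dist A X - e < mdist a x].
Proof.
move=> PA PX e0.
have [_ [a Aa [x Xx <-]] h] := sup_adherent e0 (max_dist_has_sup PA PX).
by exists a, x.
Qed.

Lemma max_dist_le A X (r : R) : P_b_cl A -> P_b_cl X ->
  (forall a x, A a -> X x -> mdist a x <= r) -> max_dist A X <= r.
Proof.
move=> PA PX h; apply: ge_sup; first by case: (max_dist_has_sup PA PX).
by move=> _ [a Aa [x Xx <-]]; exact: h.
Qed.

Definition near_maximizers_close A X (s e : R) := forall a a' x x',
  A a -> A a' -> X x -> X x' ->
  max_dist A X - s <= mdist a x -> max_dist A X - s <= mdist a' x' ->
  mdist a a' <= e /\ mdist x x' <= e.

(** The strict inequality [e' < e] leaves room to perturb [X], which makes the condition open. *)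
Definition almost_well_posed A (e : R) : set (P_b_cl_cv E) :=
  [set X | exists s e', [/\ 0 < s, e' < e & near_maximizers_close A X s e']].

Lemma hausdorff_dist_lt X Y (r : R) x : P_b_cl X -> P_b_cl Y ->
  hausdorff_dist X Y < r -> X x -> exists2 y, Y y & mdist x y < r.
Proof.
move=> PX PY XYr Xx; have [Y0 _ _] := PY; apply: set_dist_lt => //.
have /(hausdorff_distP _ PX PY)[/(_ _ Xx) + _] := lexx (hausdorff_dist X Y).
by move/le_lt_trans; exact.
Qed.

Lemma open_almost_well_posed A (e : R) :
  P_b_cl A -> open (almost_well_posed A e).
Proof.
move=> PA; rewrite openE => X [s [e' [s0 e'e XP]]].
(* Slack [s / 4] for [Y] becomes at most [s / 4 + 2 * d <= s] for [X]: one [d] for the change of the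
   maximal distance, one for replacing [y] by [x]. Diameters grow by [2 * d < e - e']. *)
pose d := Num.min (s / 4) ((e - e') / 3).
have d0 : 0 < d by rewrite lt_min !divr_gt0// subr_gt0.
have ds : d <= s / 4 by rewrite ge_min lexx.
have de : d <= (e - e') / 3 by rewrite ge_min lexx orbT.
have PX := Pbclcv_bcl X.
rewrite /interior -nbhs_ballE; exists d => //= Y.
rewrite ballEmdist/= mdist_P_b_cl_cv => XY; have PY := Pbclcv_bcl Y.
have YX y : Pbclcv_set Y y -> exists2 x, Pbclcv_set X x & mdist y x < d.
  by apply: hausdorff_dist_lt => //; rewrite hausdorff_distC.
have mXY : max_dist A X <= max_dist A Y + d.
  apply: max_dist_le => // a x Aa Xx.
  have [y Yy xy] := hausdorff_dist_lt PX PY XY Xx.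
  have := metric_triangle a y x; rewrite (metric_sym y).
  by have := max_dist_ge PA PY Aa Yy; lra.
exists (s / 4), (e' + 2 * d); split; [by rewrite divr_gt0|by lra|].
move=> a a' y y' Aa Aa' Yy Yy' ay ay'.
have [x Xx yx] := YX _ Yy; have [x' Xx' yx'] := YX _ Yy'.
have [||aa' xx'] := XP a a' x x' Aa Aa' Xx Xx'.
- by have := metric_triangle a x y; rewrite (metric_sym x y); lra.
- by have := metric_triangle a' x' y'; rewrite (metric_sym x' y'); lra.
split; first by lra.
have := metric_triangle y x y'; have := metric_triangle x x' y'.
by rewrite (metric_sym x' y'); lra.
Qed.

End max_problem.

(** * Well-posedness as a countable intersection of open conditions *)

Section well_posedness.
Context {R : realType} (E : metricType R) (A : set E).
Hypothesis PA : P_b_cl A.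
Implicit Types (X Y : P_b_cl_cv E).

Let invS_gt0 n : 0 < n.+1%:R^-1 :> R. Proof. by rewrite invr_gt0. Qed.

Lemma maximizing_sequence_harmonic X (u : nat -> E * E) :
  (forall n, A (u n).1 /\ Pbclcv_set X (u n).2) ->
  (forall n, max_dist A X - n.+1%:R^-1 <= mdist (u n).1 (u n).2) ->
  maximizing_sequence A X u.
Proof.
move=> uAX um; split=> //.
apply: (@squeeze_cvgr _ _ _ _ (fun n => max_dist A X - n.+1%:R^-1)
  (fun=> max_dist A X)).
- near=> n; rewrite um /=; have [Aa Xx] := uAX n.
  exact: max_dist_ge PA (Pbclcv_bcl X) Aa Xx.
- rewrite -[X in _ --> X]subr0; apply: cvgB; first exact: cvg_cst.
  exact: cvg_harmonic.
- exact: cvg_cst.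
Unshelve. all: by end_near. Qed.

Lemma maximizing_sequence_exists X : exists u, maximizing_sequence A X u.
Proof.
have /choice[u uP] n : exists p : E * E, [/\ A p.1, Pbclcv_set X p.2 &
    max_dist A X - n.+1%:R^-1 < mdist p.1 p.2].
  have [a [x [Aa Xx h]]] := max_dist_adherent PA (Pbclcv_bcl X) (invS_gt0 n).
  by exists (a, x).
exists u; apply: maximizing_sequence_harmonic => n; have [? ? ?] := uP n => //.
exact: ltW.
Qed.

(** Otherwise each slack [n.+1%:R^-1] admits two near-maximizing pairs more than [e / 2] apart in
    one coordinate. Both resulting sequences are maximizing, hence converge to the same [p], a
    contradiction. *)
Lemma max_well_posed_almost X (e : R) : 0 < e -> max_well_posed A X ->
  almost_well_posed A e X.
Proof.
move=> e0 [p [_ _ pP]]; apply: contrapT => nwp.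
have /choice[u uP] n : exists q : (E * E) * (E * E),
    [/\ A q.1.1, Pbclcv_set X q.1.2, A q.2.1 & Pbclcv_set X q.2.2] /\
    [/\ max_dist A X - n.+1%:R^-1 <= mdist q.1.1 q.1.2,
      max_dist A X - n.+1%:R^-1 <= mdist q.2.1 q.2.2 &
    ~ (mdist q.1.1 q.2.1 <= e / 2 /\ mdist q.1.2 q.2.2 <= e / 2)].
  apply: contrapT => nq; apply: nwp; exists n.+1%:R^-1, (e / 2).
  split; [exact: invS_gt0|by lra|move=> a a' x x' Aa Aa' Xx Xx' ax ax'].
  by apply: contrapT => far; apply: nq; exists ((a, x), (a', x')).
have [|c1 c2] := pP (fun n => (u n).1) _.
  by apply: maximizing_sequence_harmonic => n; have [[? ? ? ?] [? ? ?]] := uP n.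
have [|c3 c4] := pP (fun n => (u n).2) _.
  by apply: maximizing_sequence_harmonic => n; have [[? ? ? ?] [? ? ?]] := uP n.
have e4 : 0 < e / 4 by rewrite divr_gt0.
suff : \forall n \near \oo, False.
  by move=> /filter_ex[].
near=> n.
have d1 : mdist p.1 (u n).1.1 < e / 4
    by near: n; exact: metricType_numDomainType.cvgr_dist_lt.
have d2 : mdist p.2 (u n).1.2 < e / 4
    by near: n; exact: metricType_numDomainType.cvgr_dist_lt.
have d3 : mdist p.1 (u n).2.1 < e / 4
    by near: n; exact: metricType_numDomainType.cvgr_dist_lt.
have d4 : mdist p.2 (u n).2.2 < e / 4
    by near: n; exact: metricType_numDomainType.cvgr_dist_lt.
have [_ [_ _ far]] := uP n; apply: far.
have := metric_triangle (u n).1.1 p.1 (u n).2.1.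
have := metric_triangle (u n).1.2 p.2 (u n).2.2.
by rewrite (metric_sym (u n).1.2 p.2) (metric_sym (u n).1.1 p.1); split; lra.
Unshelve. all: by end_near. Qed.

(** A maximizing sequence ends up near-maximizing at every slack, hence is Cauchy, and its limit is
    a solution because [A] and [X] are closed. This solution is itself near-maximizing at every
    slack, so any other solution coincides with it and any maximizing sequence converges to it. *)
Lemma almost_max_well_posed X : complete_metric E ->
  (forall e : R, 0 < e -> almost_well_posed A e X) -> max_well_posed A X.
Proof.
move=> cE awp; have PX := Pbclcv_bcl X.
have [_ _ clA] := PA; have [_ _ clX] := PX.
have near_max (v : nat -> E * E) (s : R) : maximizing_sequence A X v -> 0 < s ->
    \forall n \near \oo, max_dist A X - s <= mdist (v n).1 (v n).2.
  move=> [_ vm] s0; near=> n; rewrite lerBlDr -lerBlDl.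
  apply: (le_trans (ler_norm _)); near: n; exact: cvgr_dist_le.
have [u uM] := maximizing_sequence_exists X; have [uAX u_cvg] := uM.
have ucauchy (e : R) : 0 < e -> exists N, forall m n,
    (N <= m)%N -> (N <= n)%N ->
    mdist (u m).1 (u n).1 < e /\ mdist (u m).2 (u n).2 < e.
  move=> /awp[s [e' [s0 e'e close]]]; have [N _ NP] := near_max _ _ uM s0.
  exists N => m n Nm Nn; have [Am Xm] := uAX m; have [An Xn] := uAX n.
  have [h1 h2] := close _ _ _ _ Am An Xm Xn (NP m Nm) (NP n Nn).
  by split; [exact: le_lt_trans h1 e'e|exact: le_lt_trans h2 e'e].
have lim_of (v : nat -> E) : (forall e : R, 0 < e -> exists N, forall m n,
    (N <= m)%N -> (N <= n)%N -> mdist (v m) (v n) < e) ->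
    exists l : E, v @ \oo --> l.
  move=> vc; apply: cE; apply/cauchy_ballP => e e0; have [N NP] := vc e e0.
  exists ([set v n | n in [set n | (N <= n)%N]],
    [set v n | n in [set n | (N <= n)%N]]).
    by split; exists N => // n Nn; exists n.
  by move=> _ [/= [m Nm <-] [n Nn <-]]; rewrite ballEmdist; exact: NP.
have [a0 ua] : exists l : E, (u n).1 @[n --> \oo] --> l.
  apply: lim_of => e /ucauchy[N NP]; exists N => m n Nm Nn.
  by case: (NP m n Nm Nn).
have [x0 ux] : exists l : E, (u n).2 @[n --> \oo] --> l.
  apply: lim_of => e /ucauchy[N NP]; exists N => m n Nm Nn.
  by case: (NP m n Nm Nn).
have Aa0 : A a0.
  by apply: (closed_cvg A clA _ _ ua); near=> n; case: (uAX n).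
have Xx0 : Pbclcv_set X x0.
  by apply: (closed_cvg _ clX _ _ ux); near=> n; case: (uAX n).
have max0 : mdist a0 x0 = max_dist A X.
  apply/eqP; rewrite eq_le max_dist_ge//=; apply/ler_addgt0Pr => e e0.
  have e3 : 0 < e / 3 by rewrite divr_gt0.
  near \oo => n.
  have d1 : mdist a0 (u n).1 < e / 3
    by near: n; exact: metricType_numDomainType.cvgr_dist_lt.
  have d2 : mdist x0 (u n).2 < e / 3
    by near: n; exact: metricType_numDomainType.cvgr_dist_lt.
  have d3 : max_dist A X - e / 3 <= mdist (u n).1 (u n).2.
    by near: n; exact: near_max.
  have := metric_triangle (u n).1 a0 (u n).2.
  have := metric_triangle a0 x0 (u n).2.
  by rewrite (metric_sym (u n).1 a0); lra.
exists (a0, x0); split=> //.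
- move=> [a x] [/= Aa Xx ax].
  have close e : 0 < e -> mdist a a0 <= e /\ mdist x x0 <= e.
    move=> /awp[s [e' [s0 e'e close]]].
    have mx : max_dist A X - s <= max_dist A X by rewrite gerBl ltW.
    have [||h1 h2] := close _ _ _ _ Aa Aa0 Xx Xx0; rewrite ?ax ?max0 //.
    by split; apply: ltW; [exact: le_lt_trans h1 e'e|exact: le_lt_trans h2 e'e].
  have eq0 (y z : E) : (forall e, 0 < e -> mdist y z <= e) -> y = z.
    move=> h; apply: mdist_positivity; apply/eqP; rewrite eq_le mdist_ge0 andbT.
    by apply/ler_addgt0Pr => e /h; rewrite add0r.
  by congr (_, _); apply: eq0 => e /close[].
- move=> v vM; have [vAX _] := vM.
  have close e : 0 < e -> \forall n \near \oo,
      mdist a0 (v n).1 < e /\ mdist x0 (v n).2 < e.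
    move=> /awp[s [e' [s0 e'e close]]]; near=> n; have [Av Xv] := vAX n.
    have [||h1 h2] := close _ _ _ _ Aa0 Av Xx0 Xv.
    + by rewrite max0 gerBl ltW.
    + by near: n; exact: near_max.
    + by split; [exact: le_lt_trans h1 e'e|exact: le_lt_trans h2 e'e].
  by split; apply/metricType_numDomainType.cvgrPdist_lt => e /close;
    apply: filterS => n [].
Unshelve. all: by end_near. Qed.

Lemma W_max_bigcap : complete_metric E ->
  W_max A = \bigcap_n almost_well_posed A (n.+1%:R^-1 : R).
Proof.
move=> cE; apply/seteqP; split=> [X wp n _|X XP].
  exact: max_well_posed_almost.
apply: almost_max_well_posed => // e e0.
have [n _ ne] := near_infty_natSinv_lt (PosNum e0).
have [s [e' [s0 e'n close]]] := XP n I.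
exists s, e'; split=> //; apply: lt_trans e'n _; apply: ne => /=; exact: leqnn.
Qed.

End well_posedness.

(** * Density *)

Section enlargement.
Context {R : realType} (E : metricType R).
Implicit Types (x y z : E).

Lemma set_dist_lipschitz (X : set E) x y : X !=set0 ->
  set_dist x X <= set_dist y X + mdist x y.
Proof. by move=> X0; rewrite addrC set_dist_triangle. Qed.

Lemma set_dist_trans (X Y : set E) y (r : R) : X !=set0 -> Y !=set0 ->
  (forall x, X x -> set_dist x Y <= r) -> set_dist y Y <= set_dist y X + r.
Proof.
move=> X0 Y0 XY; apply/ler_addgt0Pr => e e0.
have [|x Xx yx] := @set_dist_lt _ E y X (set_dist y X + e) X0.
  by rewrite ltrDl.
by have := set_dist_triangle y x Y0; have := XY x Xx; lra.
Qed.

Lemma mdist_le_max_dist (A X : set E) a y : P_b_cl A -> P_b_cl X -> A a ->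
  mdist a y <= max_dist A X + set_dist y X.
Proof.
move=> PA PX Aa; have [X0 _ _] := PX; apply/ler_addgt0Pr => e e0.
have [|x Xx yx] := @set_dist_lt _ E y X (set_dist y X + e) X0.
  by rewrite ltrDl.
have := max_dist_ge PA PX Aa Xx; have := metric_triangle a x y.
by rewrite (metric_sym x y); lra.
Qed.

Hypotheses (geoE : geodesic_space E) (cvE : convex_metric E).

Section cone.
Variables (X : P_b_cl_cv E) (z : E) (D t : R).
Hypotheses (D0 : 0 < D) (t0 : 0 < t).
Hypothesis XD : forall x, Pbclcv_set X x -> mdist x z <= D.

(* A convex substitute for the closed convex hull of X and z. *)
Definition cone : set E := [set y | mdist y z / D + set_dist y X / t <= 1].

Let X0 : Pbclcv_set X !=set0. Proof. by case: (Pbclcv_bcl X). Qed.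

Lemma sub_cone : Pbclcv_set X `<=` cone.
Proof.
move=> x Xx; rewrite /cone/= set_dist_refl// mul0r addr0.
by rewrite ler_pdivrMr// mul1r XD.
Qed.

(** The bound drops linearly as [y] moves away from the apex [z], which is what draws
    near-maximizers to [z]. *)
Lemma cone_set_dist y : cone y -> set_dist y X <= t * (1 - mdist y z / D).
Proof. by rewrite /cone/= -ler_pdivrMl// [t^-1 * _]mulrC => h; lra. Qed.

Lemma cone_set_dist_le y : cone y -> set_dist y X <= t.
Proof.
move/cone_set_dist/le_trans; apply; rewrite -[leRHS]mulr1 ler_pM2l// gerBl.
by rewrite divr_ge0 ?mdist_ge0// ltW.
Qed.

Lemma cone_P_b_cl : P_b_cl cone.
Proof.
have cD y : cone y -> mdist y z <= D.
  rewrite /cone/= => h; rewrite -[D]mul1r -ler_pdivrMr//.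
  have : 0 <= set_dist y X / t by rewrite divr_ge0 ?set_dist_ge0// ltW.
  by move: h; lra.
split.
- by have [x Xx] := X0; exists x; exact: sub_cone.
- exists (D + D) => x y /cD xz /cD yz.
  by rewrite (le_trans (metric_triangle x z y))// lerD// metric_sym.
- apply: (@closed_sublevel _ _ _ (D^-1 + t^-1)) => x y.
  rewrite mulrDl addrACA [D^-1 * _]mulrC [t^-1 * _]mulrC -!mulrDl.
  rewrite lerD// ler_pM2r ?invr_gt0//; last exact: set_dist_lipschitz.
  by rewrite addrC metric_triangle.
Qed.

Lemma cone_convex : geodesically_convex cone.
Proof.
apply: geodesically_convex_sublevel => x y l c cP s s01.
have h1 := convex_mdist geoE cvE z cP s01.
have h2 := convex_set_dist geoE cvE X0 (@Pbclcv_convex _ _ X) cP s01.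
have {}h1 : mdist (c (s * l)) z / D <=
    ((1 - s) * mdist x z + s * mdist y z) / D.
  by rewrite ler_pM2r ?invr_gt0.
have {}h2 : set_dist (c (s * l)) X / t <=
    ((1 - s) * set_dist x X + s * set_dist y X) / t.
  by rewrite ler_pM2r ?invr_gt0.
apply: (le_trans (lerD h1 h2)); rewrite [leLHS](_ : _ =
  (1 - s) * (mdist x z / D + set_dist x X / t) +
  s * (mdist y z / D + set_dist y X / t))//; ring.
Qed.

Definition cone_set : P_b_cl_cv E := PbclcvSet cone_P_b_cl cone_convex.

End cone.

Lemma almost_well_posed_enlargement (kappa : R) (A : set E)
    (X : P_b_cl_cv E) (t e : R) :
  geodesic_extension E -> kappa < 0 -> curvature_bounded_below E kappa ->
  P_b_cl A -> 0 < t -> 0 < e -> exists Y : P_b_cl_cv E,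
    [/\ Pbclcv_set X `<=` Pbclcv_set Y,
       forall y, Pbclcv_set Y y -> set_dist y X <= t & almost_well_posed A e Y].
Proof.
move=> ext k0 curv PA t0 e0; have PX := Pbclcv_bcl X.
have [[x0 Xx0] [N XN] _] := PX.
have N0 : 0 <= N by rewrite -(mdistxx x0) XN.
have e4 : 0 < e / 4 by rewrite divr_gt0.
have [eta eta0 nb] := nonbranching k0 geoE curv (max_dist A X + t) t0 e4.
pose D := N + t; have D0 : 0 < D by rewrite ltr_wpDl.
(* [K] converts the estimate [t * (mdist y z / D) <= 2 * s] into [mdist y z <= s * K], and [s] is
   then chosen so that [s + s * K] is the smaller of the tolerances [eta] and [e / 4]. *)
pose K := 2 * D / t; have K0 : 0 < K by rewrite divr_gt0// mulr_gt0.
pose s := Num.min eta (e / 4) / (1 + K).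
have m0 : 0 < Num.min eta (e / 4) by rewrite lt_min eta0.
have s0 : 0 < s by rewrite divr_gt0// addr_gt0.
have sE : s + s * K = Num.min eta (e / 4).
  by rewrite -[X in X + _]mulr1 -mulrDr divfK// lt0r_neq0// addr_gt0.
have seta : s + s * K <= eta by rewrite sE ge_min lexx.
have se : s + s * K <= e / 4 by rewrite sE ge_min lexx orbT.
have sK0 : 0 < s * K by rewrite mulr_gt0.
have [a [x [Aa Xx ax]]] := max_dist_adherent PA PX s0.
have [z [S [segS Sx zx xa]]] := geodesic_extend a x geoE ext (ltW t0).
have XD y : Pbclcv_set X y -> mdist y z <= D.
  move=> Xy; have := metric_triangle y x z; have := XN y x Xy Xx.
  by rewrite (metric_sym x z) zx /D; lra.
pose Y := cone_set D0 t0 XD; have PY := Pbclcv_bcl Y.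
exists Y; split; [exact: sub_cone|by move=> y /cone_set_dist_le; exact|].
have Yz : Pbclcv_set Y z.
  rewrite /= /cone/= mdistxx mul0r add0r ler_pdivrMr// mul1r -zx.
  exact: set_dist_le.
have ax' : mdist a x = mdist z a - t by rewrite metric_sym.
have zaY : mdist z a <= max_dist A Y by rewrite metric_sym max_dist_ge.
have zaM : mdist z a <= max_dist A X + t.
  by have := max_dist_ge PA PX Aa Xx; lra.
have key a' y : A a' -> Pbclcv_set Y y -> max_dist A Y - s <= mdist a' y ->
    mdist a a' <= e / 4 /\ mdist y z <= e / 4.
  move=> Aa' Yy a'y.
  have yX := cone_set_dist t0 Yy.
  have yK : mdist y z <= s * K.
    (* As [z] is in [Y], [max_dist A Y >= mdist z a > max_dist A X + t - s]; a second [s] is the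
       slack of the pair [(a', y)]. *)
    have h : t * (mdist y z / D) <= 2 * s.
      by have := mdist_le_max_dist y PA PX Aa'; lra.
    have -> : mdist y z = (t * (mdist y z / D)) * (D / t).
      by field; rewrite !lt0r_neq0.
    have -> : s * K = (2 * s) * (D / t) by rewrite /K; field; rewrite lt0r_neq0.
    by rewrite ler_pM2r// divr_gt0.
  split; last by lra.
  (* The two remaining conditions compare [a'] with [a]: seen from [z] the error is [s] plus
     [mdist y z], and seen from [x] it is [s], since [(a, x)] is near-maximizing for [X]. *)
  apply: (nb z a a' x S) => //.
    have := metric_triangle a' z y; rewrite (metric_sym a' z) (metric_sym z y).
    by lra.
  have := max_dist_ge PA PX Aa' Xx; rewrite (metric_sym a' x) (metric_sym x a).
  by lra.
exists s, (e / 2); split=> //; first by lra.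
move=> a1 a2 y1 y2 Aa1 Aa2 Yy1 Yy2 h1 h2.
have [k1 k2] := key _ _ Aa1 Yy1 h1; have [k3 k4] := key _ _ Aa2 Yy2 h2.
have := metric_triangle a1 a a2; have := metric_triangle y1 z y2.
by rewrite (metric_sym a1 a) (metric_sym z y2); split; lra.
Qed.

(** The bounds [r n - r n.+1] telescope, so the union of the increasing sets stays within [r n] of
    [X n]; [Y] is the closure of this union. *)
Lemma increasing_limit (X : nat -> P_b_cl_cv E) (r : nat -> R) :
  (forall n, 0 <= r n) ->
  (forall n, Pbclcv_set (X n) `<=` Pbclcv_set (X n.+1)) ->
  (forall n y, Pbclcv_set (X n.+1) y -> set_dist y (X n) <= r n - r n.+1) ->
  exists Y : P_b_cl_cv E, forall n, mdist (X n) Y <= r n.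
Proof.
move=> r0 Xsub Xr; pose U := \bigcup_n Pbclcv_set (X n).
have X0 n : Pbclcv_set (X n) !=set0 by case: (Pbclcv_bcl (X n)).
have U0 : U !=set0 by have [x Xx] := X0 0%N; exists x; exists 0%N.
have Xmono n m : (n <= m)%N -> Pbclcv_set (X n) `<=` Pbclcv_set (X m).
  move=> /subnK <-; elim: (m - n)%N => [|i IHi]; first by rewrite add0n.
  by rewrite addSn; apply: subset_trans IHi (Xsub _).
have Xdist n i y : Pbclcv_set (X (i + n)%N) y ->
    set_dist y (X n) <= r n - r (i + n)%N.
  elim: i y => [|i IHi] y; first by rewrite add0n subrr => /set_dist_refl ->.
  rewrite addSn => /Xr yX; have := set_dist_trans y (X0 _) (X0 _) IHi.
  by lra.
have Udist n y : U y -> set_dist y (X n) <= r n.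
  move=> [m _ Xmy]; have := r0 (m + n)%N.
  by have := @Xdist n m y (Xmono _ _ (leq_addr _ _) _ Xmy); lra.
have Ucv : geodesically_convex U.
  move=> x y S [n _ Xnx] [m _ Xmy] segS u Su; exists (maxn n m) => //.
  apply: (Pbclcv_convex (Xmono _ _ (leq_maxl _ _) _ Xnx)
    (Xmono _ _ (leq_maxr _ _) _ Xmy) segS Su).
(* The closure of [U] is written as a sublevel set of [set_dist], so that closedness and convexity
   both follow from the lemmas on sublevel sets. *)
pose C : set E := [set y | set_dist y U <= 0].
have UC : U `<=` C by move=> y Uy; rewrite /C/= set_dist_refl.
have Cdist n y : C y -> set_dist y (X n) <= r n.
  rewrite /C/= => yU.
  by have := set_dist_trans y U0 (X0 n) (Udist n); lra.
have PC : P_b_cl C.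
  split.
  - by have [u Uu] := U0; exists u; exact: UC.
  - have [[x0 Xx0] [N XN] _] := Pbclcv_bcl (X 0%N).
    have Cx0 y : C y -> mdist y x0 <= r 0%N + 1 + N.
      move=> Cy.
      have [|x Xx yx] := @set_dist_lt _ E y (X 0%N) (r 0%N + 1) (X0 _).
        by have := Cdist 0%N _ Cy; lra.
      by have := metric_triangle y x x0; have := XN _ _ Xx Xx0; lra.
    exists ((r 0%N + 1 + N) + (r 0%N + 1 + N)) => x y /Cx0 xx0 /Cx0 yx0.
    by have := metric_triangle x x0 y; rewrite (metric_sym x0); lra.
  - apply: (@closed_sublevel _ _ _ 1) => x y; rewrite mul1r.
    exact: set_dist_lipschitz.
have Ccv : geodesically_convex C.
  exact/geodesically_convex_sublevel/convex_set_dist.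
exists (PbclcvSet PC Ccv) => n; rewrite mdist_P_b_cl_cv.
apply/hausdorff_distP => //; first exact: Pbclcv_bcl.
split=> [x Xx|y /= Cy]; last exact: Cdist.
by rewrite set_dist_refl//=; apply: UC; exists n.
Qed.

(* Baire's argument; as each set contains the previous one, the limit is the
   closure of an increasing union and the completeness of P_b_cl_cv E is not needed. *)
Lemma dense_bigcap_enlargement (W : nat -> set (P_b_cl_cv E)) :
  (forall n, open (W n)) ->
  (forall n (X : P_b_cl_cv E) (t : R), 0 < t -> exists Y : P_b_cl_cv E,
    [/\ Pbclcv_set X `<=` Pbclcv_set Y,
       forall y, Pbclcv_set Y y -> set_dist y X <= t & W n Y]) ->
  dense (\bigcap_n W n).
Proof.
move=> Wopen Wdense O [X0 OX0] Oopen.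
(* Closed balls are used because the limit set is only known to satisfy [mdist (X n) Y <= r n]. *)
have ball_of (V : set (P_b_cl_cv E)) X : open V -> V X ->
    exists r : {posnum R}, forall Y, mdist X Y <= r%:num -> V Y.
  move=> Vopen VX; have : nbhs X V by apply: open_nbhs_nbhs.
  rewrite -nbhs_ballE => -[d /= d0 dV].
  have d20 : 0 < d / 2 by rewrite divr_gt0.
  exists (PosNum d20) => Y /= XY; apply: dV; rewrite ballEmdist/=.
  by apply: le_lt_trans XY _; lra.
have [r0 r0O] := ball_of O X0 Oopen OX0.
have step (p : nat * (P_b_cl_cv E * {posnum R})) :
    exists q : P_b_cl_cv E * {posnum R},
    [/\ Pbclcv_set p.2.1 `<=` Pbclcv_set q.1,
      forall y, Pbclcv_set q.1 y -> set_dist y p.2.1 <= p.2.2%:num - q.2%:num &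
      forall Y, mdist q.1 Y <= q.2%:num -> W p.1 Y].
  case: p => n [X r] /=.
  have r20 : 0 < r%:num / 2 by rewrite divr_gt0.
  have [Y [XY Yr WY]] := Wdense n X _ r20.
  have [d dW] := ball_of (W n) Y (Wopen n) WY.
  (* A new radius of at most [r%:num / 2] makes the radius drop by at least [r%:num / 2], the size
     of the enlargement. *)
  have m0 : 0 < Num.min d%:num (r%:num / 2) by rewrite lt_min r20 andbT.
  exists (Y, PosNum m0); split=> //= [y Yy|Z YZ].
    have : Num.min d%:num (r%:num / 2) <= r%:num / 2.
      by rewrite ge_min lexx orbT.
    by have := Yr y Yy; lra.
  by apply: dW; apply: le_trans YZ _; rewrite ge_min lexx.
have [f fP] := choice step.
pose u := fix u n := if n is m.+1 then f (m, u m) else (X0, r0).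
have [|n|n|Y XY] := @increasing_limit (fst \o u) (fun n => (u n).2%:num).
- by [].
- by have [] := fP (n, u n).
- by have [] := fP (n, u n).
exists Y; split; first by apply: r0O; exact: (XY 0%N).
(* The set of index [n.+1] is the one whose closed ball was chosen inside [W n]; index 0 is the
   initial ball inside [O]. *)
by move=> n _; have [_ _] := fP (n, u n); apply; exact: (XY n.+1).
Qed.

End enlargement.

Theorem theorem3p4 (R : realType) (E : metricType R) (kappa : R) (A : set E) :
  complete_metric E ->
  geodesic_space E ->
  convex_metric E ->
  geodesic_extension E ->
  kappa < 0 ->
  curvature_bounded_below E kappa ->
  P_b_cl A ->
  dense (W_max A) /\ Gdelta (W_max A).
Proof.
move=> cE geoE cvE ext k0 curv PA.
have Wopen n : open (almost_well_posed A (n.+1%:R^-1 : R)).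
  exact: open_almost_well_posed.
rewrite W_max_bigcap//; split; last by eexists; [exact: Wopen|by []].
apply: dense_bigcap_enlargement => // n X t t0.
have n0 : 0 < n.+1%:R^-1 :> R by rewrite invr_gt0.
exact: almost_well_posed_enlargement ext k0 curv PA t0 n0.
Qed.
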